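(* Consider an energy-based system (as defined in the context) with a quadratic Hamiltonian $$H(z_1,z_2)=\tfrac12\langle z_1,\mathbf{M}_1z_1\rangle+\tfrac12\langle z_2,\mathbf{M}_2z_2\rangle,$$ where $\mathbf{M}_1\in\mathbb{R}^{n_1,n_1}$ and $\mathbf{M}_2\in\mathbb{R}^{n_2,n_2}$ are symmetric. Further assume full-rank matrices $$\mathbf{V}_1\in\mathbb{R}^{n_1,r_1},\qquad \mathbf{V}_2\in\mathbb{R}^{n_2,r_2},\qquad \mathbf{V}_3\in\mathbb{R}^{n_3,r_3}$$ with $r_j\le n_j$, $j=1,2,3$, spanning approximation spaces of lower dimension, such that $\mathbf{V}_2^T\mathbf{M}_2\mathbf{V}_2$ is invertible. Then the Petrov--Galerkin approximation, which is obtained by considering the orthogonal complement to $\mathbf{V}_1$, $\mathbf{M}_2\mathbf{V}_2$, and $\mathbf{V}_3$, respectively (see the context), is again a solution of an energy-based system.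
   Context: An energy-based system with state $z=[z_1;z_2;z_3]\in\mathbb{R}^{n_1+n_2+n_3}$, $n=n_1+n_2+n_3$, energy function (Hamiltonian) $H=H(z_1,z_2)$, and input and output $u,y\in\mathbb{R}^m$ is a system of the form $$\begin{bmatrix}\partial_{z_1}H\\ \dot z_2\\ 0\end{bmatrix}=(\mathbf{J}-\mathbf{R})\begin{bmatrix}\dot z_1\\ \partial_{z_2}H\\ z_3\end{bmatrix}+\begin{bmatrix}\mathbf{B}_1\\ \mathbf{B}_2\\ \mathbf{B}_3\end{bmatrix}u,\qquad y=\begin{bmatrix}\mathbf{B}_1^T&\mathbf{B}_2^T&\mathbf{B}_3^T\end{bmatrix}\begin{bmatrix}\dot z_1\\ \partial_{z_2}H\\ z_3\end{bmatrix}$$ with constant matrices $\mathbf{J}=-\mathbf{J}^T\in\mathbb{R}^{n,n}$, $\mathbf{R}=\mathbf{R}^T\in\mathbb{R}^{n,n}$ positive semi-definite, and $\mathbf{B}_i\in\mathbb{R}^{n_i,m}$ arbitrary. Here $[x;y]$ denotes vertical stacking of column vectors, a dot is the time derivative, $\partial_{z_k}H$ is the partial gradient (column vector) of $H$ with respect to $z_k$, and $\langle x,y\rangle=x^Ty$. Petrov--Galerkin approximation: one approximates $z_j\approx\mathbf{V}_jw_j$ with $w_j\in\mathbb{R}^{r_j}$, $j=1,2,3$, inserts this into the first (dynamic) equation of the system, and requires the residuals of its three block rows to be orthogonal to the columns of $\mathbf{V}_1$, $\mathbf{M}_2\mathbf{V}_2$, and $\mathbf{V}_3$, respectively. *)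

(* Defs.v *)
From HB Require Import structures.
From mathcomp Require Import all_boot all_order all_algebra.
From mathcomp Require Import all_classical all_reals all_analysis.

Set Implicit Arguments.
Unset Strict Implicit.
Unset Printing Implicit Defensive.

Import Order.TTheory GRing.Theory Num.Theory.
Import numFieldNormedType.Exports.

Local Open Scope classical_set_scope.
Local Open Scope ring_scope.

Definition inner (R : realType) (n : nat) (x y : 'cV[R]_n) : R :=
  (x^T *m y) 0 0.

Definition stack3 (R : realType) (n1 n2 n3 p : nat) (A1 : 'M[R]_(n1, p))
    (A2 : 'M[R]_(n2, p)) (A3 : 'M[R]_(n3, p)) : 'M[R]_(n1 + n2 + n3, p) :=
  col_mx (col_mx A1 A2) A3.

Definition block1 (R : realType) (n1 n2 n3 p : nat)
  (A : 'M[R]_(n1 + n2 + n3, p)) : 'M[R]_(n1, p) := usubmx (usubmx A).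
Definition block2 (R : realType) (n1 n2 n3 p : nat)
  (A : 'M[R]_(n1 + n2 + n3, p)) : 'M[R]_(n2, p) := dsubmx (usubmx A).
Definition block3 (R : realType) (n1 n2 n3 p : nat)
  (A : 'M[R]_(n1 + n2 + n3, p)) : 'M[R]_(n3, p) := dsubmx A.

Definition grad (R : realType) (n : nat) (f : 'cV[R]_n -> R) (x : 'cV[R]_n) :
    'cV[R]_n :=
  \col_i 'D_(delta_mx i 0 : 'cV[R]_n) (f : 'cV[R]_n -> R^o) x.

Record energy_system (R : realType) (n1 n2 n3 m : nat) := EnergySystem {
  Jmx : 'M[R]_(n1 + n2 + n3);
  Rmx : 'M[R]_(n1 + n2 + n3);
  B1mx : 'M[R]_(n1, m);
  B2mx : 'M[R]_(n2, m);
  B3mx : 'M[R]_(n3, m);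
  ham : 'cV[R]_n1 -> 'cV[R]_n2 -> R;
  Jmx_skew : Jmx = - Jmx^T;
  Rmx_sym : Rmx = Rmx^T;
  Rmx_psd : forall x : 'cV[R]_(n1 + n2 + n3), 0 <= inner x (Rmx *m x);
  (* regularity making the partial gradients meaningful *)
  ham_diff : forall p : 'cV[R]_n1 * 'cV[R]_n2,
    differentiable
      ((fun q => ham q.1 q.2) : 'cV[R]_n1 * 'cV[R]_n2 -> R^o) p
}.

Section System.
Context (R : realType) (n1 n2 n3 m : nat) (S : energy_system R n1 n2 n3 m).

Definition d1ham (x1 : 'cV[R]_n1) (x2 : 'cV[R]_n2) : 'cV[R]_n1 :=
  grad (fun x => ham S x x2) x1.

Definition d2ham (x1 : 'cV[R]_n1) (x2 : 'cV[R]_n2) : 'cV[R]_n2 :=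
  grad (fun x => ham S x1 x) x2.

Definition Bmx : 'M[R]_(n1 + n2 + n3, m) := stack3 (B1mx S) (B2mx S) (B3mx S).

Section Trajectory.
Context (z1 : R -> 'cV[R]_n1) (z2 : R -> 'cV[R]_n2) (z3 : R -> 'cV[R]_n3).

Definition dyn_lhs (t : R) : 'cV[R]_(n1 + n2 + n3) :=
  stack3 (d1ham (z1 t) (z2 t)) (derive1 z2 t) 0.

Definition effort (t : R) : 'cV[R]_(n1 + n2 + n3) :=
  stack3 (derive1 z1 t) (d2ham (z1 t) (z2 t)) (z3 t).

Definition dyn_rhs (u : R -> 'cV[R]_m) (t : R) : 'cV[R]_(n1 + n2 + n3) :=
  (Jmx S - Rmx S) *m effort t + Bmx *m u t.

Definition residual (u : R -> 'cV[R]_m) (t : R) : 'cV[R]_(n1 + n2 + n3) :=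
  dyn_lhs t - dyn_rhs u t.

(* No derivative of z3 enters the equations, so z3 needs no regularity. *)
Definition is_solution (T : set R) (u y : R -> 'cV[R]_m) : Prop :=
  forall t, T t ->
    [/\ derivable z1 t 1, derivable z2 t 1,
        dyn_lhs t = dyn_rhs u t & y t = Bmx^T *m effort t].

End Trajectory.

(* Coefficients w_j of an ansatz z_j = V_j w_j for which the j-th block row of
   the residual is orthogonal to the columns of W_j at all times in T.  *)
Definition petrov_galerkin (r1 r2 r3 : nat)
    (V1 : 'M[R]_(n1, r1)) (V2 : 'M[R]_(n2, r2)) (V3 : 'M[R]_(n3, r3))
    (W1 : 'M[R]_(n1, r1)) (W2 : 'M[R]_(n2, r2)) (W3 : 'M[R]_(n3, r3))
    (T : set R) (w1 : R -> 'cV[R]_r1) (w2 : R -> 'cV[R]_r2)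
    (w3 : R -> 'cV[R]_r3) (u : R -> 'cV[R]_m) : Prop :=
  forall t, T t ->
    let res := residual (fun s => V1 *m w1 s) (fun s => V2 *m w2 s)
                 (fun s => V3 *m w3 s) u t in
    [/\ derivable w1 t 1 /\ derivable w2 t 1,
        forall j, inner (col j W1) (block1 res) = 0,
        forall j, inner (col j W2) (block2 res) = 0 &
        forall j, inner (col j W3) (block3 res) = 0].

End System.

(* Main.v *)
(** For the quadratic Hamiltonian the second effort of the ansatz is
    [M2 V2 w2 = W2 (K2 w2)] with [K2 = V2^T M2 V2] and [W2 = M2 V2 K2^-1], so the
    full effort is [P] times the effort of a system with Hamiltonian
    [1/2 <w1, V1^T M1 V1 w1> + 1/2 <w2, K2 w2>], where [P = diag(V1, W2, V3)].
    [W2] and [M2 V2] have the same column space, so the Petrov-Galerkin condition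
    says that [P^T] annihilates the residual; as [W2^T V2 = 1], this is the
    dynamic equation with structure matrices [P^T J P], [P^T R P], [P^T B]. *)

Require Import Defs.
From HB Require Import structures.
From mathcomp Require Import all_boot all_order all_algebra.
From mathcomp Require Import all_classical all_reals all_analysis.

Set Implicit Arguments.
Unset Strict Implicit.
Unset Printing Implicit Defensive.

Import Order.TTheory GRing.Theory Num.Theory.
Import numFieldNormedType.Exports.

Local Open Scope classical_set_scope.
Local Open Scope ring_scope.

(** * Inner products and orthogonality to columns *)

Lemma inner_sum (R : realType) (n : nat) (x y : 'cV[R]_n) :
  inner x y = \sum_i x i 0 * y i 0.
Proof. by rewrite /inner mxE; apply: eq_bigr => i _; rewrite mxE. Qed.

Lemma innerC (R : realType) (n : nat) (x y : 'cV[R]_n) : inner x y = inner y x.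
Proof. by rewrite !inner_sum; apply: eq_bigr => i _; rewrite mulrC. Qed.

Lemma inner_mulmxr (R : realType) (n p : nat) (A : 'M[R]_(n, p))
    (x : 'cV[R]_n) (y : 'cV[R]_p) :
  inner x (A *m y) = inner (A^T *m x) y.
Proof. by rewrite /inner trmx_mul trmxK mulmxA. Qed.

Lemma inner_col_eq0 (R : realType) (n p : nat) (A : 'M[R]_(n, p))
    (x : 'cV[R]_n) :
  (forall j, inner (col j A) x = 0) <-> A^T *m x = 0.
Proof.
have E j : inner (col j A) x = (A^T *m x) j 0.
  by rewrite inner_sum mxE; apply: eq_bigr => i _; rewrite !mxE.
split=> [h|h j]; last by rewrite E h mxE.
by apply/colP => j; rewrite -E h mxE.
Qed.

(** * Derivatives of matrix-valued maps and of quadratic forms *)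

Lemma is_derive_mxP (R : realType) (V : normedModType R) (n p : nat)
    (w : V -> 'M[R]_(n, p)) (t v : V) (dw : 'M[R]_(n, p)) :
  is_derive t v w dw <->
  forall i j, is_derive t v (fun s => w s i j) (dw i j).
Proof.
split=> [[wt <-] i j|wt].
  by apply: DeriveDef; [move/derivable_mxP : wt|rewrite derive_mx// mxE].
have wt' : derivable w t v by apply/derivable_mxP => i j; case: (wt i j).
apply: DeriveDef => //; rewrite derive_mx//; apply/matrixP => i j.
by rewrite mxE; case: (wt i j).
Qed.

Lemma is_derive_mulmx (R : realType) (V : normedModType R) (m n p : nat)
    (A : 'M[R]_(m, n)) (w : V -> 'M[R]_(n, p)) (t v : V) (dw : 'M[R]_(n, p)) :
  is_derive t v w dw -> is_derive t v (fun s => A *m w s) (A *m dw).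
Proof.
move=> /is_derive_mxP wt; apply/is_derive_mxP => i j.
have -> : (fun s => (A *m w s) i j) = \sum_k (A i k \*: fun s => w s k j).
  by apply/funext => s; rewrite mxE fct_sumE.
by rewrite mxE; apply: is_derive_sum => k; apply: is_deriveZ.
Qed.

(** The product rule yields [inner x (A *m v)] and [inner v (A *m x)]; symmetry of [A] makes them
    equal, and the factor one half absorbs the doubling. *)
Lemma is_derive_quadratic (R : realType) (n : nat) (A : 'M[R]_n)
    (x v : 'cV[R]_n) :
  A^T = A ->
  is_derive x v (fun y => 2^-1 * inner y (A *m y)) (inner v (A *m x)).
Proof.
move=> AT.
have xi i : is_derive x v (fun y : 'cV[R]_n => y i 0) (v i 0).
  by have /is_derive_mxP := is_derive_id x v.
have Axi i : is_derive x v (fun y : 'cV[R]_n => (A *m y) i 0) ((A *m v) i 0).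
  by have /is_derive_mxP := is_derive_mulmx A (is_derive_id x v).
have -> : (fun y => 2^-1 * inner y (A *m y)) =
    2^-1 \*: \sum_i ((fun y : 'cV[R]_n => y i 0) * (fun y => (A *m y) i 0)).
  by apply/funext => y; rewrite inner_sum fct_sumE.
apply: is_derive_eq; rewrite big_split/=.
have -> : \sum_i x i 0 *: (A *m v) i 0 = inner v (A *m x).
  by rewrite inner_mulmxr AT innerC inner_sum.
have -> : \sum_i (A *m x) i 0 *: v i 0 = inner v (A *m x).
  by rewrite innerC inner_sum.
by rewrite -mulr2n -[X in _ *: X]mulr_natl [LHS]mulKf// pnatr_eq0.
Qed.

(** Directional derivatives along all vectors do not give the full differentiability that the field
    [ham_diff] demands. Here the form is built by sums and products from the coordinate maps. *)
Lemma differentiable_quadratic (R : realType) (n : nat) (A : 'M[R]_n)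
    (x : 'cV[R]_n) :
  differentiable (fun y => 2^-1 * inner y (A *m y)) x.
Proof.
have dcoord i := @differentiable_coord R n 1 x i 0.
have dA i : differentiable (fun y : 'cV[R]_n => (A *m y) i 0) x.
  have -> : (fun y : 'cV[R]_n => (A *m y) i 0) =
      \sum_j (A i j \*: fun y : 'cV[R]_n => y j 0).
    by apply/funext => y; rewrite mxE fct_sumE.
  by apply: differentiable_sum => j; apply: differentiableZ.
have -> : (fun y => 2^-1 * inner y (A *m y)) =
    2^-1 \*: \sum_i ((fun y : 'cV[R]_n => y i 0) * (fun y => (A *m y) i 0)).
  by apply/funext => y; rewrite inner_sum fct_sumE.
apply: differentiableZ; apply: differentiable_sum => i.
exact: differentiableM.
Qed.

(** The derivative along the basis vector [delta_mx i 0] reads off entry [i] of [g]. *)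
Lemma grad_eq (R : realType) (n : nat) (f : 'cV[R]_n -> R) (x g : 'cV[R]_n) :
  (forall v, is_derive x v f (inner v g)) -> grad f x = g.
Proof.
move=> fg; apply/colP => i; rewrite mxE.
have [_ ->] := fg (delta_mx i 0).
rewrite inner_sum (bigD1 i)//= big1 ?addr0 => [|j ji]; rewrite mxE eqxx.
  by rewrite eqxx mul1r.
by rewrite (negPf ji) mul0r.
Qed.

(** * Partial gradients of a quadratic Hamiltonian *)

Section QuadraticHamiltonian.
Context (R : realType) (n1 n2 n3 m : nat) (S : energy_system R n1 n2 n3 m).
Context (M1 : 'M[R]_n1) (M2 : 'M[R]_n2).
Hypotheses (M1_sym : M1^T = M1) (M2_sym : M2^T = M2).
Hypothesis ham_quadratic : forall (z1 : 'cV[R]_n1) (z2 : 'cV[R]_n2),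
  ham S z1 z2 = 2^-1 * inner z1 (M1 *m z1) + 2^-1 * inner z2 (M2 *m z2).

(** Freezing the other argument leaves a quadratic form plus a constant. The system is arbitrary, so
    this serves both the given and the reduced one. *)
Lemma d1ham_quadratic z1 z2 : d1ham S z1 z2 = M1 *m z1.
Proof.
apply: grad_eq => v.
have -> : (fun x => ham S x z2) = (fun x => 2^-1 * inner x (M1 *m x)) +
    cst (2^-1 * inner z2 (M2 *m z2)).
  by apply/funext => x; rewrite ham_quadratic.
rewrite -[inner v _]addr0.
by apply: is_deriveD; apply: is_derive_quadratic.
Qed.

Lemma d2ham_quadratic z1 z2 : d2ham S z1 z2 = M2 *m z2.
Proof.
apply: grad_eq => v.
have -> : (fun x => ham S z1 x) = cst (2^-1 * inner z1 (M1 *m z1)) +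
    (fun x => 2^-1 * inner x (M2 *m x)).
  by apply/funext => x; rewrite ham_quadratic.
rewrite -[inner v _]add0r.
by apply: is_deriveD; apply: is_derive_quadratic.
Qed.

End QuadraticHamiltonian.

(** * Block-diagonal matrices acting on stacked vectors *)

Section Stack.
Context (R : realType) (n1 n2 n3 p : nat).

Lemma stack3_block (A : 'M[R]_(n1 + n2 + n3, p)) :
  stack3 (block1 A) (block2 A) (block3 A) = A.
Proof. by rewrite /stack3 /block1 /block2 !vsubmxK. Qed.

Lemma stack3_eq0 (A1 : 'M[R]_(n1, p)) (A2 : 'M[R]_(n2, p))
    (A3 : 'M[R]_(n3, p)) :
  stack3 A1 A2 A3 = 0 <-> [/\ A1 = 0, A2 = 0 & A3 = 0].
Proof.
split=> [|[-> -> ->]]; last by rewrite /stack3 !col_mx0.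
rewrite /stack3 => /eqP; rewrite !col_mx_eq0 => /andP[/andP[]].
by move=> /eqP ? /eqP ? /eqP ?.
Qed.

Context (r1 r2 r3 : nat).

(** The nesting mirrors that of [stack3], so products reduce block by block with [mul_block_col]. *)
Definition diag3 (V1 : 'M[R]_(n1, r1)) (V2 : 'M[R]_(n2, r2))
    (V3 : 'M[R]_(n3, r3)) : 'M[R]_(n1 + n2 + n3, r1 + r2 + r3) :=
  block_mx (block_mx V1 0 0 V2) 0 0 V3.

Lemma mul_diag3_stack3 V1 V2 V3 (A1 : 'M[R]_(r1, p)) (A2 : 'M[R]_(r2, p))
    (A3 : 'M[R]_(r3, p)) :
  diag3 V1 V2 V3 *m stack3 A1 A2 A3 = stack3 (V1 *m A1) (V2 *m A2) (V3 *m A3).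
Proof. by rewrite /stack3 !mul_block_col !mul0mx !addr0 !add0r. Qed.

End Stack.

Lemma tr_diag3 (R : realType) (n1 n2 n3 r1 r2 r3 : nat) (V1 : 'M[R]_(n1, r1))
    (V2 : 'M[R]_(n2, r2)) (V3 : 'M[R]_(n3, r3)) :
  (diag3 V1 V2 V3)^T = diag3 V1^T V2^T V3^T.
Proof. by rewrite /diag3 !tr_block_mx !trmx0. Qed.

(** * Transforming the structure matrices by congruence *)

Section ReducedSystem.
Context (R : realType) (n1 n2 n3 m r1 r2 r3 : nat).
Context (S : energy_system R n1 n2 n3 m).
Context (V1 : 'M[R]_(n1, r1)) (V2 : 'M[R]_(n2, r2)) (V3 : 'M[R]_(n3, r3)).
Context (K1 : 'M[R]_r1) (K2 : 'M[R]_r2).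
Let P := diag3 V1 V2 V3.

Fact congruence_skew : P^T *m Jmx S *m P = - (P^T *m Jmx S *m P)^T.
Proof.
by rewrite !trmx_mul trmxK {1}Jmx_skew mulmxN mulNmx mulmxA.
Qed.

Fact congruence_sym : P^T *m Rmx S *m P = (P^T *m Rmx S *m P)^T.
Proof. by rewrite !trmx_mul trmxK -Rmx_sym mulmxA. Qed.

(** Moving [P^T] across the inner product gives the form of [Rmx S] at [P *m x]. *)
Fact congruence_psd (x : 'cV[R]_(r1 + r2 + r3)) :
  0 <= inner x (P^T *m Rmx S *m P *m x).
Proof. by rewrite -!mulmxA inner_mulmxr trmxK; apply: Rmx_psd. Qed.

Fact quadratic_ham_diff (p : 'cV[R]_r1 * 'cV[R]_r2) :
  differentiable ((fun q => 2^-1 * inner q.1 (K1 *m q.1) +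
    2^-1 * inner q.2 (K2 *m q.2)) : 'cV[R]_r1 * 'cV[R]_r2 -> R^o) p.
Proof.
have dfst : differentiable (fst : 'cV[R]_r1 * 'cV[R]_r2 -> 'cV[R]_r1) p.
  by apply: linear_differentiable => q; exact: cvg_fst.
have dsnd : differentiable (snd : 'cV[R]_r1 * 'cV[R]_r2 -> 'cV[R]_r2) p.
  by apply: linear_differentiable => q; exact: cvg_snd.
apply: differentiableD.
  exact: differentiable_comp dfst (differentiable_quadratic K1 _).
exact: differentiable_comp dsnd (differentiable_quadratic K2 _).
Qed.

(** The Hamiltonian matrices are independent of the congruence: in the theorem the middle block is
    [W2], whereas [K2] is built from [V2]. *)
Definition congruence_system : energy_system R r1 r2 r3 m :=
  EnergySystem (ham := fun z1 z2 => 2^-1 * inner z1 (K1 *m z1) +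
      2^-1 * inner z2 (K2 *m z2))
    (V1^T *m B1mx S) (V2^T *m B2mx S) (V3^T *m B3mx S)
    congruence_skew congruence_sym congruence_psd quadratic_ham_diff.

End ReducedSystem.

Theorem lemma2p5 (R : realType) (n1 n2 n3 m r1 r2 r3 : nat)
    (S : energy_system R n1 n2 n3 m)
    (M1 : 'M[R]_n1) (M2 : 'M[R]_n2)
    (M1_sym : M1^T = M1) (M2_sym : M2^T = M2)
    (ham_quadratic : forall (z1 : 'cV[R]_n1) (z2 : 'cV[R]_n2),
       ham S z1 z2 = 2^-1 * inner z1 (M1 *m z1) + 2^-1 * inner z2 (M2 *m z2))
    (V1 : 'M[R]_(n1, r1)) (V2 : 'M[R]_(n2, r2)) (V3 : 'M[R]_(n3, r3))
    (r1_le : (r1 <= n1)%N) (r2_le : (r2 <= n2)%N) (r3_le : (r3 <= n3)%N)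
    (V1_full : \rank V1 = r1) (V2_full : \rank V2 = r2)
    (V3_full : \rank V3 = r3)
    (V2M2V2_inv : V2^T *m M2 *m V2 \in unitmx) :
  exists Sr : energy_system R r1 r2 r3 m,
    forall (T : set R) (w1 : R -> 'cV[R]_r1) (w2 : R -> 'cV[R]_r2)
      (w3 : R -> 'cV[R]_r3) (u : R -> 'cV[R]_m),
      petrov_galerkin S V1 V2 V3 V1 (M2 *m V2) V3 T w1 w2 w3 u <->
      exists y : R -> 'cV[R]_m, is_solution Sr w1 w2 w3 T u y.
Proof.
set K1 := V1^T *m M1 *m V1; set K2 := V2^T *m M2 *m V2.
have K1_sym : K1^T = K1 by rewrite /K1 !trmx_mul trmxK M1_sym mulmxA.
have K2_sym : K2^T = K2 by rewrite /K2 !trmx_mul trmxK M2_sym mulmxA.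
set W2 := M2 *m V2 *m invmx K2.
have trW2 : W2^T = invmx K2 *m (M2 *m V2)^T.
  by rewrite /W2 trmx_mul trmx_inv K2_sym.
have W2V2 : W2^T *m V2 = 1%:M.
  by rewrite trW2 trmx_mul M2_sym -mulmxA mulVmx.
have W2K2 : W2 *m K2 = M2 *m V2 by rewrite /W2 mulmxKV.
pose P := diag3 V1 W2 V3.
pose Sr := congruence_system S V1 W2 V3 K1 K2.
exists Sr => T w1 w2 w3 u.
(* Derivability of [w1] and [w2] lets the constant matrices [V1] and [V2] leave the time
   derivatives. *)
have res_red t : derivable w1 t 1 -> derivable w2 t 1 ->
    P^T *m residual S (fun s => V1 *m w1 s) (fun s => V2 *m w2 s)
      (fun s => V3 *m w3 s) u t = residual Sr w1 w2 w3 u t.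
  move=> /derivableP w1t /derivableP w2t.
  have eff : effort S (fun s => V1 *m w1 s) (fun s => V2 *m w2 s)
      (fun s => V3 *m w3 s) t = P *m effort Sr w1 w2 w3 t.
    rewrite /effort mul_diag3_stack3 (d2ham_quadratic M2_sym ham_quadratic).
    (* The Hamiltonian of [Sr] has the required quadratic form by definition. *)
    rewrite (@d2ham_quadratic _ _ _ _ _ Sr K1 K2)// !derive1E.
    have [_ ->] := is_derive_mulmx V1 w1t.
    by rewrite [in RHS]mulmxA W2K2 mulmxA.
  (* The first block produces [K1]; in the second, [W2V2] leaves the bare derivative of [w2], as the
     form of an energy-based system requires. *)
  have lhs : P^T *m dyn_lhs S (fun s => V1 *m w1 s) (fun s => V2 *m w2 s) t =
      dyn_lhs Sr w1 w2 t.
    rewrite /dyn_lhs tr_diag3 mul_diag3_stack3 mulmx0.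
    rewrite (d1ham_quadratic M1_sym ham_quadratic).
    rewrite (@d1ham_quadratic _ _ _ _ _ Sr K1 K2)// !derive1E.
    have [_ ->] := is_derive_mulmx V2 w2t.
    by rewrite (mulmxA _ V2) W2V2 mul1mx /K1 !mulmxA.
  rewrite /residual mulmxBr lhs /dyn_rhs mulmxDr eff; congr (_ - (_ + _)).
    by rewrite !mulmxA mulmxBr mulmxBl.
  by rewrite mulmxA /Bmx tr_diag3 mul_diag3_stack3.
have orth X : [/\ forall j, inner (col j V1) (block1 X) = 0,
        forall j, inner (col j (M2 *m V2)) (block2 X) = 0 &
        forall j, inner (col j V3) (block3 X) = 0] <-> P^T *m X = 0.
  (* Occurrence 4 is the [X] in [P^T *m X]; the other three already sit inside blocks. *)
  rewrite -{4}[X]stack3_block tr_diag3 mul_diag3_stack3.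
  have W2_eq0 : W2^T *m block2 X = 0 <-> (M2 *m V2)^T *m block2 X = 0.
    (* The two matrices differ by the left factor [invmx K2], which multiplication by [K2]
       undoes. *)
    rewrite trW2 -mulmxA; split=> [/(congr1 (mulmx K2))|->]; last exact: mulmx0.
    by rewrite mulmx0 mulKVmx.
  split=> [[/inner_col_eq0 o1 /inner_col_eq0/W2_eq0 o2 /inner_col_eq0 o3]|].
    exact/stack3_eq0.
  by case/stack3_eq0 => o1 /W2_eq0 o2 o3; split; apply/inner_col_eq0.
split=> [pg|[y sol] t Tt].
  (* The Petrov-Galerkin condition does not constrain an output, so [y] is defined by the output
     equation of [Sr]. *)
  exists (fun t => (Bmx Sr)^T *m effort Sr w1 w2 w3 t) => t Tt.
  have [[w1t w2t] o1 o2 o3] := pg t Tt.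
  (* The difference of the two sides is, by unfolding, the residual of [Sr], which [res_red] turns
     into the projected residual of [S]. *)
  split=> //; apply/eqP; rewrite -subr_eq0 -[_ - _]res_red//; apply/eqP.
  exact/orth.
have [w1t w2t eq_dyn _] := sol t Tt.
suff /orth[] : P^T *m residual S (fun s => V1 *m w1 s) (fun s => V2 *m w2 s)
    (fun s => V3 *m w3 s) u t = 0 by [].
by rewrite res_red// /residual eq_dyn subrr.
Qed.
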